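(* Let $B,\bar B$ be real or complex vector spaces and $L(\varepsilon)=\sum_{i=0}^\infty\varepsilon^iL_i$ a formal power series with $L_i\in L(B,\bar B)$, $L(\varepsilon)\not\equiv0$. Let $k\ge0$, assume that $L(\varepsilon)$ stabilizes at $k$, and run the recursion of the context with some choice of complements. Let $H_1,\dots,H_{k+1}\in L(\bar B,B)$ be the operators defined in the context. Then for every $l\ge k+1$ $$\begin{pmatrix} M_{1,k+1+l} \\ \vdots \\ M_{k+1,k+1+l} \end{pmatrix}=\begin{pmatrix} H_1 & & \\ \vdots & \ddots & \\ H_{k+1} & \cdots & H_1 \end{pmatrix}\cdot\begin{pmatrix} \bar S_{k+1+l} \\ \vdots \\ \bar S_{1+l} \end{pmatrix},$$ where the matrix on the right is the lower triangular $(k+1)\times(k+1)$ block Toeplitz matrix with $(i,j)$ entry $H_{i-j+1}$ for $i\ge j$; that is, $M_{i,k+1+l}=\sum_{j=1}^{i}H_{i-j+1}\bar S_{k+2+l-j}$ for $i=1,\dots,k+1$.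
   Context: $L(X,Y)$ denotes the linear maps from $X$ to $Y$; $N[T]$ is the kernel of $T$; $I_X$ is the identity. Stabilization. For $k\ge1$ let $\Delta^k:B^k\to\bar B^k$ be the upper triangular block Toeplitz operator with $(i,j)$ entry $L_{j-i}$ for $j\ge i$ and $0$ otherwise, so that $\Delta^k(b_{k-1},\dots,b_0)^T=0$ iff $\sum_{i+j=m}L_ib_j=0$ for $m=0,\dots,k-1$. For $b_0\in B$ put $\mathrm{rank}(b_0)=0$ if $b_0\notin N[L_0]$, and otherwise $\mathrm{rank}(b_0)=\sup\{k\ge1\mid\exists (b_{k-1},\dots,b_0)\in B^k:\ \Delta^k(b_{k-1},\dots,b_0)^T=0\}\in\mathbb{N}\cup\{\infty\}$. $L(\varepsilon)$ stabilizes at $k\ge0$ if $\mathrm{rank}(b_0)\in\{0,\dots,k\}\cup\{\infty\}$ for all $b_0\in B$ and there exists $b_0$ with $\mathrm{rank}(b_0)=k$. Recursion. Put $N_0:=B$, $N_0^c:=\{0\}$, $R_0:=\{0\}$, $R_0^c:=\bar B$, $\bar S_1:=S_1:=L_0$, $E_{1,1}:=M_{1,1}:=I_B$. At each stage $j\ge1$, given $S_j\in L(B,R_{j-1}^c)$, set $N_j:=\{n\in N_{j-1}\mid S_jn=0\}$, $R_j:=S_j(N_{j-1})$ and choose algebraic direct complements $N_{j-1}=N_j^c\oplus N_j$, $R_{j-1}^c=R_j\oplus R_j^c$. Then $B=N_1^c\oplus\cdots\oplus N_j^c\oplus N_j$ and $\bar B=R_1\oplus\cdots\oplus R_j\oplus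 R_j^c$; $\mathcal P_j$ denotes the projection of $\bar B$ onto $R_j$ defined by the latter decomposition, and $S_j^{-1}:R_j\to N_j^c$ denotes the inverse of the bijection $S_j|_{N_j^c}:N_j^c\to R_j$. At stage $j\ge2$, the operators are defined by $$\bar S_j:=\sum_{i=1}^{j-1}L_iM_{i,j-1},\qquad S_j:=(I_{\bar B}-\mathcal P_1-\cdots-\mathcal P_{j-1})\bar S_j,$$ $$E_{j,j}:=I_B,\qquad E_{i,j}:=-S_i^{-1}\mathcal P_i\sum_{\nu=i+1}^{j}\bar S_\nu E_{\nu,j}\quad (i=j-1,\dots,1),$$ $$M_{1,j}:=E_{1,j},\qquad M_{i,j}:=\sum_{\nu=i}^{j}M_{i-1,\nu-1}E_{\nu,j}\quad(i=2,\dots,j).$$ The recursion is continued for all $j$. $M^{(k)}$ is the upper triangular $k\times k$ operator matrix with entries $M_{i,j}$ for $i\le j$ and $0$ for $i>j$. Operators $H_i$. Put $B_i:=\bar S_iS_i^{-1}\mathcal P_i\in L(\bar B,\bar B)$, and $$e_{k+1,k+2}:=-S_{k+1}^{-1}\mathcal P_{k+1},\qquad e_{i,k+2}:=-S_i^{-1}\mathcal P_i(I_{\bar B}-B_{i+1})\cdots(I_{\bar B}-B_{k+1})\quad(1\le i\le k).$$ Then $$\begin{pmatrix} H_1 \\ \vdots \\ H_{k+1} \end{pmatrix}:=\begin{pmatrix} I_B & 0 \\ 0 & M^{(k)} \end{pmatrix}\cdot\begin{pmatrix} e_{1,k+2} \\ \vdots \\ e_{k+1,k+2} \end{pmatrix}$$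 (for $k=0$ this reads $H_1=e_{1,2}=-S_1^{-1}\mathcal P_1$). *)

(* Defs.v *)
From HB Require Import structures.
From mathcomp Require Import all_boot all_order all_algebra.
From mathcomp Require Import boolp classical_sets functions reals.
From mathcomp Require Import complex.

Set Implicit Arguments.
Unset Strict Implicit.
Unset Printing Implicit Defensive.

Import Order.TTheory GRing.Theory.

Local Open Scope classical_set_scope.
Local Open Scope ring_scope.

Variant scalar_kind := RealScalars | ComplexScalars.

Definition scalars (R : realType) (s : scalar_kind) : fieldType :=
  match s with
  | RealScalars => R
  | ComplexScalars => R[i]
  end.

Section Subspaces.
Context {K : fieldType} {V : lmodType K}.

Definition subspace (A : set V) : Prop := submod_closed [in A].

(* U = V1 (+) V2, an algebraic (not topological) direct sum of subspaces *)
Definition direct_sum (U V1 V2 : set V) : Prop :=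
  [/\ subspace V1, subspace V2,
      U = [set v1 + v2 | v1 in V1 & v2 in V2]
    & V1 `&` V2 = [set 0]].

End Subspaces.

Section Stabilization.
Context {K : fieldType} {B Bbar : lmodType K}.
Variable L : nat -> {linear B -> Bbar}.

Definition Delta (k : nat) (x : 'I_k -> B) : 'I_k -> Bbar :=
  fun i => \sum_(j < k | (i <= j)%N) L (j - i)%N (x j).

(* (b_{k-1}, ..., b_0)^T *)
Definition stack (k : nat) (b : nat -> B) : 'I_k -> B :=
  fun i => b (k.-1 - i)%N.

Definition chain_lengths (b0 : B) : set nat :=
  [set k : nat | (1 <= k)%N /\
    exists b : nat -> B, b 0%N = b0 /\ Delta (stack b : 'I_k -> B) = 0].

(* N u {oo} is [option nat], with [None] for oo; [supremum 0] is used only on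
   bounded sets, which are nonempty here since they contain 1. *)
Definition rank (b0 : B) : option nat :=
  if `[< L 0%N b0 <> 0 >] then Some 0%N
  else if `[< has_ubound (chain_lengths b0) >]
       then Some (supremum 0%N (chain_lengths b0))
       else None.

Definition stabilizes (k : nat) : Prop :=
  (forall b0 : B,
     rank b0 = None \/ exists m : nat, (m <= k)%N /\ rank b0 = Some m) /\
  (exists b0 : B, rank b0 = Some k).

End Stabilization.

Section Recursion.
Context {K : fieldType} {B Bbar : lmodType K}.

(* N_j, N_j^c, R_j, R_j^c, \bar S_j, S_j, P_j, S_j^{-1}, E_{i,j}, M_{i,j}, with
   the same indices: the first four are used for j >= 0, the next four for
   j >= 1, the last two for 1 <= i <= j; other values are unconstrained.
   Operators are plain functions, with pointwise sums (zmodType on [T -> V]);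
   their linearity follows from that of L and the equations of [recursion].
   Only the restriction of [Sinv j] to [Rng j] is meaningful; it is always
   precomposed with [Proj j]. *)
Record operators := Operators {
  Nker : nat -> set B;
  Nc : nat -> set B;
  Rng : nat -> set Bbar;
  Rc : nat -> set Bbar;
  Sbar : nat -> B -> Bbar;
  Sop : nat -> B -> Bbar;
  Proj : nat -> Bbar -> Bbar;
  Sinv : nat -> Bbar -> B;
  Eop : nat -> nat -> B -> B;
  Mop : nat -> nat -> B -> B }.

Record recursion (L : nat -> {linear B -> Bbar}) (D : operators) : Prop :=
  Recursion {
  rec_N0 : Nker D 0 = setT;
  rec_Nc0 : Nc D 0 = [set 0];
  rec_R0 : Rng D 0 = [set 0];
  rec_Rc0 : Rc D 0 = setT;
  rec_Sbar1 : Sbar D 1 = L 0%N;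
  rec_S1 : Sop D 1 = L 0%N;
  rec_M11 : Mop D 1 1 = id;
  rec_N : forall j, (1 <= j)%N ->
    Nker D j = [set n | Nker D j.-1 n /\ Sop D j n = 0];
  rec_R : forall j, (1 <= j)%N -> Rng D j = Sop D j @` Nker D j.-1;
  rec_Nc : forall j, (1 <= j)%N -> direct_sum (Nker D j.-1) (Nc D j) (Nker D j);
  rec_Rc : forall j, (1 <= j)%N -> direct_sum (Rc D j.-1) (Rng D j) (Rc D j);
  rec_P : forall j, (1 <= j)%N -> forall (r : nat -> Bbar) (c : Bbar),
    (forall i, (1 <= i <= j)%N -> Rng D i (r i)) -> Rc D j c ->
    Proj D j (\sum_(1 <= i < j.+1) r i + c) = r j;
  rec_Sinv : forall j, (1 <= j)%N -> forall r, Rng D j r ->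
    Nc D j (Sinv D j r) /\ Sop D j (Sinv D j r) = r;
  rec_Sbar : forall j, (2 <= j)%N ->
    Sbar D j = \sum_(1 <= i < j) (L i \o Mop D i j.-1);
  rec_S : forall j, (2 <= j)%N ->
    Sop D j = (id - \sum_(1 <= i < j) Proj D i) \o Sbar D j;
  rec_Ejj : forall j, (1 <= j)%N -> Eop D j j = id;
  rec_E : forall i j, (1 <= i < j)%N ->
    Eop D i j =
      - (Sinv D i \o Proj D i
         \o \sum_(i.+1 <= nu < j.+1) (Sbar D nu \o Eop D nu j));
  rec_M1 : forall j, (2 <= j)%N -> Mop D 1 j = Eop D 1 j;
  rec_M : forall i j, (2 <= i <= j)%N ->
    Mop D i j = \sum_(i <= nu < j.+1) (Mop D i.-1 nu.-1 \o Eop D nu j) }.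

Variable D : operators.

Definition Bop (i : nat) : Bbar -> Bbar := Sbar D i \o Sinv D i \o Proj D i.

(* e_{i,k+2} for 1 <= i <= k+1; the product is empty (= id) for i = k+1 *)
Definition eop (k i : nat) : Bbar -> B :=
  - (Sinv D i \o Proj D i \o \big[comp/id]_(i.+1 <= m < k.+2) (id - Bop m)).

(* (i, j) entry, 1 <= i, j <= k+1, of the block matrix diag(I_B, M^(k)) *)
Definition diag_IM (i j : nat) : B -> B :=
  if (i == 1)%N && (j == 1)%N then id
  else if (2 <= i <= j)%N then Mop D i.-1 j.-1 else 0.

Definition Hop (k i : nat) : Bbar -> B :=
  \sum_(1 <= j < k.+2) (diag_IM i j \o eop k j).

End Recursion.

(* Main.v *)
Require Import Defs.
From mathcomp Require Import all_boot all_order all_algebra.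
From mathcomp Require Import boolp classical_sets functions reals.
From mathcomp Require Import zify.
Import GRing.Theory.
Local Open Scope ring_scope.

(** Write Q_n = I - P_1 - ... - P_n, so that S_{n+1} = Q_n \bar S_{n+1}. The
    canonical chain b_m = M_{n-m,n} x shows that every x in N_n starts a chain
    of length n; conversely, if b_0, ..., b_n satisfies the equations of order
    less than n, then Q_n applied to its residual of order n is S_{n+1} b_0.
    Hence N_n is the set of heads of chains of length n, and stabilization at k
    forces R_j = 0 for j >= k+2. Then E_{i,j} = 0 for k+2 <= i < j, unwinding
    the recursion for the remaining E_{i,j} gives E_{i,j} = e_{i,k+2} \bar S_j,
    and therefore M_{i,j} = M_{i-1,j-1} + H_i \bar S_j for j >= k+2. *)

(** * Additive maps, triangular sums and subspaces *)

Section SubtractionMorphisms.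
Context {U V : zmodType} {f : U -> V} (fB : {morph f : x y / x - y}).

(** The operators of the recursion are plain functions, so their additivity is carried around as
    compatibility with subtraction, a single condition that yields the rest. *)
Lemma morphB0 : f 0 = 0.
Proof. by rewrite -[X in f X](subrr 0) fB subrr. Qed.

Lemma morphBN x : f (- x) = - f x.
Proof. by rewrite -[- x]sub0r fB morphB0 sub0r. Qed.

Lemma morphBD x y : f (x + y) = f x + f y.
Proof. by rewrite -{1}[y]opprK fB morphBN opprK. Qed.

End SubtractionMorphisms.

Lemma sum_morphB (U V : zmodType) m n (F : nat -> U -> V) :
    (forall i, (m <= i < n)%N -> {morph F i : x y / x - y}) ->
  {morph (fun x => \sum_(m <= i < n) F i x) : x y / x - y}.
Proof.
move=> FB x y /=; rewrite -sumrB; apply: eq_big_nat => i mi; exact: FB.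
Qed.

Lemma exchange_sum_triangle (V : nmodType) m n (F : nat -> nat -> V) :
  \sum_(m <= i < n) \sum_(i <= j < n) F i j =
  \sum_(m <= j < n) \sum_(m <= i < j.+1) F i j.
Proof.
transitivity (\sum_(m <= i < n) \sum_(m <= j < n | (i <= j)%N) F i j).
  apply: eq_big_nat => i /andP[mi _]; rewrite (big_nat_widenl _ m) //=.
rewrite (exchange_big_dep_nat xpredT) //=; apply: eq_big_nat => j /andP[_ jn].
by rewrite (big_nat_widen _ j.+1 n).
Qed.

Section Subspace.
Context {K : fieldType} {V : lmodType K} {A : set V} (hA : subspace A).

Lemma subspace0 : A 0.
Proof. by case: hA; rewrite inE. Qed.

Lemma subspaceB x y : A x -> A y -> A (x - y).
Proof.
move=> Ax Ay; have [_ lA] := hA.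
have := lA (-1) y x; rewrite !inE => /(_ Ay Ax).
by rewrite scaleN1r addrC.
Qed.

End Subspace.

(** * Chains and the coefficients of L(eps) b(eps) *)

Section Chains.
Context {K : fieldType} {B Bbar : lmodType K}.
Context (L : nat -> {linear B -> Bbar}).

(* The coefficient of eps^m in L(eps) b(eps). *)
Definition residual (m : nat) (b : nat -> B) : Bbar :=
  \sum_(0 <= i < m.+1) L i (b (m - i)%N).

(** A series with zero head is eps times the shifted series. *)
Lemma residual_shift (m : nat) (b : nat -> B) :
  b 0%N = 0 -> residual m.+1 b = residual m (b \o succn).
Proof.
move=> b0; rewrite /residual big_nat_recr //= subnn b0 linear0 addr0.
by apply: eq_big_nat => i im; congr (L i (b _)); lia.
Qed.

Lemma residualB (m : nat) (b c : nat -> B) :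
  residual m (b - c) = residual m b - residual m c.
Proof. by rewrite /residual -sumrB; apply: eq_bigr => i _; rewrite linearB. Qed.

Lemma Delta_stack (k : nat) (b : nat -> B) (i : 'I_k) :
  Delta L (stack b : 'I_k -> B) i = residual (k.-1 - i) b.
Proof.
have ik := ltn_ord i.
rewrite /Delta /stack /residual.
rewrite -(big_mkord (fun j => (i <= j)%N) (fun j => L (j - i)%N (b (k.-1 - j)%N))).
transitivity (\sum_(i <= j < k) L (j - i)%N (b (k.-1 - j)%N)).
  by rewrite [RHS](big_nat_widenl _ 0).
rewrite -{1}[nat_of_ord i]add0n big_addn.
have -> : (k.-1 - i).+1 = (k - i)%N by lia.
by apply: eq_big_nat => j jk; rewrite addnK; congr (L j (b _)); lia.
Qed.

Lemma chain_lengthsP (b0 : B) (k : nat) :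
  chain_lengths L b0 k <->
  (1 <= k)%N /\ exists b, b 0%N = b0 /\ forall m, (m < k)%N -> residual m b = 0.
Proof.
split=> -[k1 [b [bb0 h]]]; split=> //; exists b; split=> //.
  (* [stack] lists a chain by decreasing index, so the equation of order m is row [k.-1 - m]. *)
  move=> m mk; have im : (k.-1 - m < k)%N by lia.
  have := congr1 (fun f => f (Ordinal im)) h.
  rewrite Delta_stack /=.
  by have -> : (k.-1 - (k.-1 - m))%N = m by lia.
apply/funext => i; rewrite Delta_stack; apply: h; have := ltn_ord i; lia.
Qed.

(** Bounded lengths would give a finite rank that is at least n > k, which stabilization
    excludes. *)
Lemma stabilizes_unbounded (k n : nat) (b0 : B) :
  stabilizes L k -> (k < n)%N -> chain_lengths L b0 n ->
  ~ has_ubound (chain_lengths L b0).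
Proof.
move=> [/(_ b0) stab _] kn cn ub.
have L0 : L 0%N b0 = 0.
  have [n1 [b [<- /(_ 0%N n1)]]] := (chain_lengthsP _ _).1 cn.
  by rewrite /residual big_nat1 subnn.
have := stab; rewrite /rank asboolF; last by move/(_ L0).
rewrite asboolT // => -[//|[m [mk [mE]]]].
have := ge_supremum_Nmem 0%N (nat_supremums_neq0 ub) cn.
by rewrite mE Order.NatOrder.leEnat; lia.
Qed.

End Chains.

(** * Decompositions of [Bbar] and their projections *)

Section Recursion.
Context {K : fieldType} {B Bbar : lmodType K}.
Context {L : nat -> {linear B -> Bbar}} {D : @operators K B Bbar}.
Context (rec : recursion L D).

Definition coproj (n : nat) : Bbar -> Bbar := id - \sum_(1 <= i < n.+1) Proj D i.

Lemma coprojE n y : coproj n y = y - \sum_(1 <= i < n.+1) Proj D i y.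
Proof. by rewrite /coproj fct_sumE. Qed.

Lemma coproj0 y : coproj 0 y = y.
Proof. by rewrite coprojE big_geq // subr0. Qed.

Lemma coprojS n y : coproj n.+1 y = coproj n y - Proj D n.+1 y.
Proof. by rewrite !coprojE big_nat_recr //= opprD addrA. Qed.

Lemma SopE j x : Sop D j.+1 x = coproj j (Sbar D j.+1 x).
Proof.
case: j => [|j]; first by rewrite coproj0 (rec_S1 rec) (rec_Sbar1 rec).
by rewrite (rec_S rec).
Qed.

Lemma Rng_subspace j : subspace (Rng D j.+1).
Proof. by have [] := rec_Rc rec (ltn0Sn j). Qed.

Lemma Rc_subspace j : subspace (Rc D j).
Proof.
case: j => [|j]; last by have [] := rec_Rc rec (ltn0Sn j).
by rewrite (rec_Rc0 rec); split=> [|a x y _ _]; rewrite inE.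
Qed.

Lemma Rc_split j y :
  Rc D j y -> exists r c, [/\ Rng D j.+1 r, Rc D j.+1 c & y = r + c].
Proof.
have [_ _ -> _] := rec_Rc rec (ltn0Sn j).
by case=> r rR [c cR <-]; exists r, c.
Qed.

Lemma RngD_Rc j r c : Rng D j.+1 r -> Rc D j.+1 c -> Rc D j (r + c).
Proof.
by move=> rR cR; have [_ _ -> _] := rec_Rc rec (ltn0Sn j); exists r => //; exists c.
Qed.

Lemma Rng_sub_Rc j r : Rng D j.+1 r -> Rc D j r.
Proof.
move=> rR; rewrite -[r]addr0; apply: RngD_Rc => //.
exact: subspace0 (Rc_subspace _).
Qed.

Lemma Rc_sub j c : Rc D j.+1 c -> Rc D j c.
Proof.
move=> cR; rewrite -[c]add0r; apply: RngD_Rc => //.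
exact: subspace0 (Rng_subspace _).
Qed.

(** [rec_P] describes [Proj D n.+1] only on sums r_1 + ... + r_{n+1} + c. By induction Q_n y lies in
    R_n^c, so splitting it as r + c writes y in that form, and [rec_P] reads off r. *)
Lemma Proj_coproj_mem n y :
  (forall i, (1 <= i <= n)%N -> Rng D i (Proj D i y)) /\ Rc D n (coproj n y).
Proof.
elim: n => [|n [IHr IHc]].
  by split=> [i|]; [lia | rewrite (rec_Rc0 rec)].
have [r [c [rR cR yE]]] := Rc_split _ _ IHc.
have Py : Proj D n.+1 y = r.
  pose r' i := if (i <= n)%N then Proj D i y else r.
  have <- : \sum_(1 <= i < n.+2) r' i + c = y.
    rewrite big_nat_recr //= /r' ltnn -addrA -yE coprojE addrC -addrA.
    rewrite [X in _ + X](_ : _ = 0) ?addr0 // addrC; apply/eqP; rewrite subr_eq0.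
    by apply/eqP/eq_big_nat => i; rewrite ltnS => /andP[_ ->].
  rewrite (rec_P rec) //; first by rewrite /r' ltnn.
  move=> i i1; rewrite /r'; case: ifP => [iN|iN]; first by apply: IHr; lia.
  by have -> : i = n.+1 by lia.
split=> [i i1|]; last by rewrite coprojS Py yE addrC addKr.
have [iN|->] : (i <= n)%N \/ i = n.+1 by lia.
  by apply: IHr; lia.
by rewrite Py.
Qed.

Lemma Proj_Rng j y : Rng D j.+1 (Proj D j.+1 y).
Proof. by have [h _] := Proj_coproj_mem j.+1 y; apply: h; rewrite leqnn. Qed.

Lemma coproj_Rc j y : Rc D j (coproj j y).
Proof. by have [] := Proj_coproj_mem j y. Qed.

Lemma Proj_uniq j y r c :
  Rng D j.+1 r -> Rc D j.+1 c -> coproj j y = r + c -> Proj D j.+1 y = r.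
Proof.
move=> rR cR yE; have [_ _ _ cap0] := rec_Rc rec (ltn0Sn j).
apply/eqP; rewrite -subr_eq0; apply/eqP.
have : (Rng D j.+1 `&` Rc D j.+1)%classic (Proj D j.+1 y - r).
  split; first exact: (subspaceB (Rng_subspace _)) (Proj_Rng _ _) _.
  have -> : Proj D j.+1 y - r = c - coproj j.+1 y.
    by rewrite coprojS yE opprB opprD addrCA [c + _]addrCA subrr addr0.
  exact: (subspaceB (Rc_subspace _)) (coproj_Rc _ _).
by rewrite cap0.
Qed.

(** Additivity comes from uniqueness of the decomposition: the difference of the components of x and
    y decomposes Q_j (x - y). *)
Lemma coprojB j : {morph coproj j : x y / x - y}.
Proof.
elim: j => [|j IH] x y; first by rewrite !coproj0.
rewrite !coprojS.
suff -> : Proj D j.+1 (x - y) = Proj D j.+1 x - Proj D j.+1 y.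
  by rewrite IH !opprB addrACA [in RHS]addrACA; congr (_ + _); rewrite addrC.
apply: (@Proj_uniq _ _ _ (coproj j.+1 x - coproj j.+1 y)).
- exact: (subspaceB (Rng_subspace _)) (Proj_Rng _ _) (Proj_Rng _ _).
- exact: (subspaceB (Rc_subspace _)) (coproj_Rc _ _) (coproj_Rc _ _).
by rewrite IH !coprojS addrACA -opprD !(addrC (Proj _ _ _)) !subrK.
Qed.

Lemma ProjE j y : Proj D j.+1 y = coproj j y - coproj j.+1 y.
Proof. by rewrite coprojS opprB addrCA subrr addr0. Qed.

Lemma ProjB j : {morph Proj D j.+1 : x y / x - y}.
Proof.
move=> x y; rewrite !ProjE !coprojB !opprB addrACA [in RHS]addrACA.
by congr (_ + _); rewrite addrC.
Qed.

Lemma coproj_id j y : Rc D j y -> coproj j y = y.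
Proof.
elim: j => [|j IH] yR; first exact: coproj0.
have yj := IH (Rc_sub _ _ yR).
rewrite coprojS yj (@Proj_uniq _ _ 0 y) ?subr0 ?add0r //.
exact: subspace0 (Rng_subspace _).
Qed.

Lemma coproj_Rng0 j y : Rng D j.+1 y -> coproj j.+1 y = 0.
Proof.
move=> yR; have yj := coproj_id _ _ (Rng_sub_Rc _ _ yR).
rewrite coprojS yj (@Proj_uniq _ _ y 0) ?subrr ?addr0 //.
exact: subspace0 (Rc_subspace _).
Qed.

(** The part y - Q_j y is killed by Q_j, so it has no component in R_{j+1} either. *)
Lemma coprojS_coproj j y : coproj j.+1 (coproj j y) = coproj j.+1 y.
Proof.
rewrite -{2}[y](subrK (coproj j y)) (morphBD (coprojB _)).
have -> : coproj j.+1 (y - coproj j y) = 0; last by rewrite add0r.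
have h : coproj j (y - coproj j y) = 0.
  by rewrite coprojB (coproj_id _ _ (coproj_Rc _ _)) subrr.
rewrite coprojS h (@Proj_uniq _ _ 0 0) ?subrr ?addr0 //.
  exact: subspace0 (Rng_subspace _).
exact: subspace0 (Rc_subspace _).
Qed.

(** * The kernels N_j, the inverses and additivity of all operators *)

Lemma Nc_subspace j : subspace (Nc D j.+1).
Proof. by have [] := rec_Nc rec (ltn0Sn j). Qed.

Lemma Nker_subspace j : subspace (Nker D j).
Proof.
case: j => [|j]; last by have [] := rec_Nc rec (ltn0Sn j).
by rewrite (rec_N0 rec); split=> [|a x y _ _]; rewrite inE.
Qed.

Lemma NkerS j x : Nker D j.+1 x <-> Nker D j x /\ Sop D j.+1 x = 0.
Proof. by rewrite (rec_N rec). Qed.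

Lemma Nker_le i j x : (i <= j)%N -> Nker D j x -> Nker D i x.
Proof.
elim: j => [|j IH]; first by rewrite leqn0 => /eqP ->.
rewrite leq_eqVlt => /orP[/eqP -> //|ij] /NkerS[xj _]; exact: IH.
Qed.

Lemma Nc_Nker j x : Nc D j.+1 x -> Nker D j x.
Proof.
move=> xN; have [_ _ /= -> _] := rec_Nc rec (ltn0Sn j).
by exists x => //; exists 0; [exact: subspace0 (Nker_subspace _)|rewrite addr0].
Qed.

Lemma Sop_inj j x y : {morph Sop D j.+1 : x y / x - y} ->
  Nc D j.+1 x -> Nc D j.+1 y -> Sop D j.+1 x = Sop D j.+1 y -> x = y.
Proof.
move=> SB xN yN xy; apply/eqP; rewrite -subr_eq0; apply/eqP.
have [_ _ _ cap0] := rec_Nc rec (ltn0Sn j).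
have xyN := subspaceB (Nc_subspace _) _ _ xN yN.
have : (Nc D j.+1 `&` Nker D j.+1)%classic (x - y).
  by split=> //; apply/NkerS; split; [exact: Nc_Nker|rewrite SB xy subrr].
by rewrite cap0.
Qed.

Lemma SopB_of_SbarB j :
  {morph Sbar D j.+1 : x y / x - y} -> {morph Sop D j.+1 : x y / x - y}.
Proof. by move=> SB x y; rewrite !SopE SB coprojB. Qed.

(** S_{j+1} is additive and injective on N_{j+1}^c. Additivity of [Sbar] is assumed at this one
    index so that the result can serve inside the induction that proves it. *)
Lemma SinvB j : {morph Sbar D j.+1 : x y / x - y} ->
  {morph (Sinv D j.+1 \o Proj D j.+1) : x y / x - y}.
Proof.
move=> /SopB_of_SbarB SB x y /=.
have hS z := rec_Sinv rec (ltn0Sn j) (Proj_Rng j z).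
apply: (Sop_inj _ _ _ SB).
- by case: (hS (x - y)).
- by apply: (subspaceB (Nc_subspace _)); [case: (hS x)|case: (hS y)].
by rewrite SB !(proj2 (hS _)) ProjB.
Qed.

Lemma EopE i j x : (i.+1 < j)%N -> Eop D i.+1 j x =
  - Sinv D i.+1 (Proj D i.+1 (\sum_(i.+2 <= nu < j.+1) Sbar D nu (Eop D nu j x))).
Proof.
by move=> ij; rewrite (rec_E rec) //; congr (- _); rewrite /= fct_sumE.
Qed.

Lemma SbarE j x :
  Sbar D j.+2 x = \sum_(1 <= i < j.+2) L i (Mop D i j.+1 x).
Proof. by rewrite (rec_Sbar rec) // fct_sumE. Qed.

Lemma Mop1E j : Mop D 1 j.+1 = Eop D 1 j.+1.
Proof.
by case: j => [|j]; [rewrite (rec_M11 rec) (rec_Ejj rec)|exact: (rec_M1 rec)].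
Qed.

Lemma MopE i j x : (i < j)%N -> Mop D i.+2 j.+1 x =
  \sum_(i.+2 <= nu < j.+2) Mop D i.+1 nu.-1 (Eop D nu j.+1 x).
Proof. by move=> ij; rewrite (rec_M rec) ?fct_sumE. Qed.

(** Simultaneous strong induction on the column: [Sbar] uses the previous column of M, [Eop] uses
    [Sbar] up to this column, and [Mop] uses [Eop] and earlier columns of M. *)
Lemma Eop_Mop_morphB j :
  [/\ {morph Sbar D j.+1 : x y / x - y},
      forall i, (1 <= i <= j.+1)%N -> {morph Eop D i j.+1 : x y / x - y}
    & forall i, (1 <= i <= j.+1)%N -> {morph Mop D i j.+1 : x y / x - y}].
Proof.
elim/ltn_ind: j => j IH.
have SB m : (m <= j)%N -> {morph Sbar D m.+1 : x y / x - y}.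
  rewrite leq_eqVlt => /orP[/eqP ->|mj]; last by have [] := IH m mj.
  move: IH {m}; case: j => [|j] IH; first by rewrite (rec_Sbar1 rec); exact: raddfB.
  move=> x y; rewrite !SbarE -sumrB; apply: eq_big_nat => i i1.
  by have [_ _ /(_ i) ->] := IH j (ltnSn j) => //; rewrite linearB.
have EB i : (1 <= i <= j.+1)%N -> {morph Eop D i j.+1 : x y / x - y}.
  (* Rows are treated upward from the diagonal, d being the distance to it; the second disjunct
     covers rows outside the triangle. *)
  have [d] : exists d, (i + d)%N = j.+1 \/ (j.+1 < i)%N by exists (j.+1 - i)%N; lia.
  elim/ltn_ind: d i => d IHd [//|i] [di|//]; last lia.
  move=> i1; have [->|ij] : (i.+1 = j.+1)%N \/ (i < j)%N by lia.
    by rewrite (rec_Ejj rec).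
  move=> x y; rewrite !EopE //.
  set X := fun x => \sum_(i.+2 <= nu < j.+2) Sbar D nu (Eop D nu j.+1 x).
  have XB : X (x - y) = X x - X y.
    apply: (@sum_morphB _ _ _ _ (fun nu z => Sbar D nu (Eop D nu j.+1 z))).
    move=> -[//|nu] nu1 {}x {}y.
    rewrite (IHd (j.+1 - nu.+1)%N) ?SB //; lia.
  rewrite -/(X x) -/(X y) -/(X (x - y)) XB.
  have ij' : (i <= j)%N by lia.
  by have /= -> := SinvB _ (SB _ ij') (X x) (X y); rewrite opprB opprK addrC.
split=> //; first exact: SB.
case=> [//|[|i]] i1; first by rewrite Mop1E; exact: EB.
move=> x y; rewrite !MopE //.
apply: (@sum_morphB _ _ _ _ (fun nu z => Mop D i.+1 nu.-1 (Eop D nu j.+1 z))).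
move=> -[//|[|nu]] nu1 {}x {}y; first lia.
rewrite EB; last lia.
have [|_ _ MB] := IH nu; first lia.
by rewrite /= MB //; lia.
Qed.

Lemma SbarB j : {morph Sbar D j.+1 : x y / x - y}.
Proof. by have [] := Eop_Mop_morphB j. Qed.

(** * Identities for the columns of E and M *)

Lemma tail_sumS i j x : (i < j)%N ->
  let X p := \sum_(p <= nu < j.+2) Sbar D nu (Eop D nu j.+1 x) in
  X i.+1 = X i.+2 - Bop D i.+1 (X i.+2).
Proof.
move=> ij X; rewrite {1}/X big_ltn; last lia.
by rewrite EopE // (morphBN (SbarB _)) addrC.
Qed.

(** Q_i turns \bar S_{i+1} into S_{i+1}, which cancels its inverse on R_{i+1}. *)
Lemma coproj_Bop i y : coproj i (Bop D i.+1 y) = Proj D i.+1 y.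
Proof.
by rewrite /Bop /= -SopE; have [] := rec_Sinv rec (ltn0Sn i) (Proj_Rng i y).
Qed.

(* By [coproj_Bop], [coproj i] of the tail sum starting at i+1 does not depend
   on i; the two extreme values of i give both sides. *)
Lemma sum_Sbar_Eop j x :
  \sum_(1 <= nu < j.+2) Sbar D nu (Eop D nu j.+1 x) = Sop D j.+1 x.
Proof.
pose X p := \sum_(p <= nu < j.+2) Sbar D nu (Eop D nu j.+1 x).
suff h d i : (i + d)%N = j -> coproj i (X i.+1) = Sop D j.+1 x.
  by rewrite -(h j 0%N) ?coproj0.
elim: d i => [|d IH] i idj.
  by have -> : i = j; [lia|rewrite /X big_nat1 (rec_Ejj rec) // SopE].
rewrite /X tail_sumS -?/(X _); last lia.
by rewrite coprojB coproj_Bop -coprojS IH //; lia.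
Qed.

(** Expanding M_{i,j+1} for i >= 2 and exchanging the sums collects the inner sums into \bar S_nu
    E_{nu,j+1}. *)
Lemma sum_L_Mop1 j x :
  \sum_(1 <= i < j.+2) L i.-1 (Mop D i j.+1 x) = Sop D j.+1 x.
Proof.
rewrite -sum_Sbar_Eop !(big_ltn (isT : (1 < j.+2)%N)) Mop1E (rec_Sbar1 rec).
congr (_ + _).
transitivity (\sum_(2 <= i < j.+2) \sum_(i <= nu < j.+2)
    L i.-1 (Mop D i.-1 nu.-1 (Eop D nu j.+1 x))).
  apply: eq_big_nat => -[//|[//|i]] i1; rewrite MopE; last lia.
  by rewrite linear_sum.
rewrite exchange_sum_triangle; apply: eq_big_nat => -[//|[//|nu]] _.
by rewrite SbarE big_add1.
Qed.

Lemma sum_L_MopS p j x : (p < j)%N ->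
  \sum_(p.+2 <= i < j.+2) L (i - p.+2)%N (Mop D i j.+1 x) =
  \sum_(p.+2 <= nu < j.+2) \sum_(p.+1 <= i < nu)
    L (i - p.+1)%N (Mop D i nu.-1 (Eop D nu j.+1 x)).
Proof.
move=> pj; transitivity (\sum_(p.+2 <= i < j.+2) \sum_(i <= nu < j.+2)
    L (i - p.+2)%N (Mop D i.-1 nu.-1 (Eop D nu j.+1 x))).
  apply: eq_big_nat => -[//|[//|i]] i1; rewrite MopE; last lia.
  by rewrite linear_sum.
rewrite exchange_sum_triangle; apply: eq_big_nat => nu _.
by rewrite big_add1.
Qed.

(** Lowering p passes to the earlier columns nu - 1, applied to E_{nu,j+1} x. This vector lies in
    N_{nu-1}: it is x on the diagonal, and belongs to N_nu^c otherwise. *)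
Lemma sum_L_Mop_eq0 p j x : (p <= j)%N -> Nker D j.+1 x ->
  \sum_(p.+1 <= i < j.+2) L (i - p.+1)%N (Mop D i j.+1 x) = 0.
Proof.
elim: p j x => [|p IH] j x pj xN.
  under eq_bigr do rewrite subn1.
  by rewrite sum_L_Mop1; case/NkerS: xN.
rewrite sum_L_MopS // big1_seq // => -[|[|nu]]; rewrite mem_index_iota //.
move=> /andP[_ nuj] /=; apply: IH; first lia.
have [nE|nuj'] : nu = j.-1 \/ (nu.+2 < j.+1)%N by lia.
  have jE : j.+1 = nu.+2 by lia.
  by rewrite jE (rec_Ejj rec) //; apply: Nker_le xN; lia.
rewrite EopE // -[- _]sub0r.
apply: (subspaceB (Nker_subspace _)); first exact: subspace0 (Nker_subspace _).
exact: Nc_Nker (proj1 (rec_Sinv rec (ltn0Sn nu.+1) (Proj_Rng _ _))).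
Qed.

(** * Canonical chains and the kernels N_n as sets of heads *)

Definition Mop_chain n x m : B := if (m <= n)%N then Mop D (n.+1 - m) n.+1 x else 0.

Lemma Mop_diag j : Mop D j.+1 j.+1 = id.
Proof.
elim: j => [|j IH]; first exact: rec_M11 rec.
apply/funext => x; rewrite MopE //.
by rewrite big_nat1 /= IH (rec_Ejj rec).
Qed.

Lemma Mop_chain0 n x : Mop_chain n x 0 = x.
Proof. by rewrite /Mop_chain subn0 Mop_diag. Qed.

Lemma residual_Mop_chain n x m : (m <= n)%N -> Nker D n.+1 x ->
  residual L m (Mop_chain n x) = 0.
Proof.
(* Order m corresponds to p = n - m. *)
move=> mn xN; have pn : (n - m <= n)%N by lia.
rewrite -[RHS](sum_L_Mop_eq0 _ _ _ pn xN) /residual.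
rewrite -[X in \sum_(X <= _ < _) L (_ - _)%N _]add0n big_addn.
have -> : (n.+2 - (n - m).+1 = m.+1)%N by lia.
apply: eq_big_nat => i im; rewrite addnK /Mop_chain ifT; last lia.
by congr (L i (Mop D _ _ x)); lia.
Qed.

Lemma residual_Mop_chainS n x :
  residual L n.+1 (Mop_chain n x) = Sbar D n.+2 x.
Proof.
rewrite /residual big_ltn // SbarE subn0 /Mop_chain ltnn linear0 add0r.
apply: eq_big_nat => i i1; rewrite ifT; last lia.
by congr (L i (Mop D _ _ x)); lia.
Qed.

(* Subtracting the canonical chain with the same head and shifting reduces the
   order by one. *)
Lemma coproj_residual n b : (forall m, (m < n)%N -> residual L m b = 0) ->
  Nker D n (b 0%N) /\ coproj n (residual L n b) = Sop D n.+1 (b 0%N).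
Proof.
elim: n b => [|n IH] b hb.
  rewrite (rec_N0 rec) coproj0 (rec_S1 rec) /residual big_nat1.
  by split.
have [bN bS] : Nker D n (b 0%N) /\ coproj n (residual L n b) = Sop D n.+1 (b 0%N).
  by apply: IH => m mn; apply: hb; lia.
have bN1 : Nker D n.+1 (b 0%N).
  by apply/NkerS; split=> //; rewrite -bS hb // (morphB0 (coprojB _)).
split=> //.
pose c := b - Mop_chain n (b 0%N).
have c0 : c 0%N = 0 by rewrite /c /= -[LHS]/(b 0%N - Mop_chain _ _ _) Mop_chain0 subrr.
have [|dN dS] := IH (c \o succn).
  move=> m mn; rewrite -residual_shift // residualB hb // residual_Mop_chain //.
  by rewrite subrr.
move: dS; rewrite -residual_shift // residualB residual_Mop_chainS => dS.
(* Q_n of this difference is S_{n+1} c_1 with c_1 in N_n, hence lies in R_{n+1}, where Q_{n+1}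
   vanishes. *)
have : coproj n.+1 (residual L n.+1 b - Sbar D n.+2 (b 0%N)) = 0.
  rewrite -coprojS_coproj dS; apply: coproj_Rng0.
  by rewrite (rec_R rec) //; exists (c 1%N).
by rewrite coprojB -SopE => /eqP; rewrite subr_eq0 => /eqP.
Qed.

Lemma Nker_chain_lengths n x : Nker D n.+1 x <-> chain_lengths L x n.+1.
Proof.
rewrite chain_lengthsP; split=> [xN|[_ [b [<- hb]]]].
  split=> //; exists (Mop_chain n x); split=> [|m mn]; first exact: Mop_chain0.
  exact: residual_Mop_chain.
by have [] := coproj_residual n.+1 b hb.
Qed.

Lemma chain_lengths_le m n x : (1 <= m <= n)%N ->
  chain_lengths L x n -> chain_lengths L x m.
Proof.
move=> mn; rewrite !chain_lengthsP => -[_ [b [b0 hb]]]; split; first lia.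
by exists b; split=> // i im; apply: hb; lia.
Qed.

(** * Consequences of stabilization *)

Section Stabilized.
Context {k : nat} (stab : stabilizes L k).

(** The head of a chain longer than k starts chains of every length, so N_j is contained in N_{j+1}
    and S_{j+1} vanishes on it. *)
Lemma Rng_stab j y : (k < j)%N -> Rng D j.+1 y -> y = 0.
Proof.
case: j => [//|j] kj; rewrite (rec_R rec) // => -[x /= xN <-].
suff /NkerS[] : Nker D j.+2 x by [].
have xc := (Nker_chain_lengths _ _).1 xN.
apply/Nker_chain_lengths; apply: contrapT => nx.
apply: (stabilizes_unbounded _ _ _ _ stab kj xc); exists j.+1 => n nc.
rewrite Order.NatOrder.leEnat leqNgt; apply/negP => jn; apply: nx.
by apply: chain_lengths_le nc; lia.
Qed.

Lemma Eop_stab i j x : (k < i)%N -> (i.+1 < j)%N -> Eop D i.+1 j x = 0.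
Proof.
move=> ki ij; rewrite EopE // (Rng_stab _ _ ki (Proj_Rng _ _)).
(* [Sinv] is a bare function: its value at 0 is found from injectivity of S_{i+1} on N_{i+1}^c. *)
have R0 := subspace0 (Rng_subspace i).
have [Sn S0] := rec_Sinv rec (ltn0Sn i) R0.
rewrite (_ : Sinv D i.+1 0 = 0) ?oppr0 //.
apply: (Sop_inj _ _ _ (SopB_of_SbarB _ (SbarB i))) => //.
  exact: subspace0 (Nc_subspace _).
by rewrite S0 (morphB0 (SopB_of_SbarB _ (SbarB i))).
Qed.

(** Each step up from row k + 1 applies one more factor I - B to the tail sum, by [tail_sumS]. *)
Lemma Eop_eop i j x : (i <= k < j)%N ->
  Eop D i.+1 j.+1 x = eop D k i.+1 (Sbar D j.+1 x).
Proof.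
move=> ij; rewrite EopE; last lia.
congr (- Sinv D _ (Proj D _ _)).
have [d] : exists d, (i + d)%N = k by exists (k - i)%N; lia.
elim: d i ij => [|d IH] i ij idk.
  (* In the tail from k + 2 on, only the diagonal term survives, leaving \bar S_{j+1} x. *)
  have -> : i = k by lia.
  rewrite [in RHS]big_geq // big_nat_recr /=; last lia.
  rewrite (rec_Ejj rec) // big1_seq ?add0r // => -[|nu].
    by rewrite mem_index_iota.
  rewrite mem_index_iota => nuj.
  rewrite Eop_stab; [exact: morphB0 (SbarB _)|lia|lia].
rewrite tail_sumS; last lia.
rewrite [in RHS]big_ltn /=; last lia.
by rewrite IH //; lia.
Qed.

Lemma Hop1 y : Hop D k 1 y = eop D k 1 y.
Proof.
rewrite /Hop fct_sumE big_ltn // big1_seq ?addr0 // => -[|[|j]];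
  by rewrite mem_index_iota.
Qed.

Lemma HopS i y : (i < k)%N -> Hop D k i.+2 y =
  \sum_(i.+2 <= nu < k.+2) Mop D i.+1 nu.-1 (eop D k nu y).
Proof.
move=> ik; rewrite /Hop fct_sumE (@big_cat_nat _ _ _ i.+2) //=; last lia.
rewrite big1_seq ?add0r.
  apply: eq_big_nat => nu nuk; rewrite /diag_IM /=.
  by rewrite ifT //; lia.
move=> nu; rewrite mem_index_iota => nui; rewrite /diag_IM /= ifF //; lia.
Qed.

Lemma Mop1_stab j x : (k < j)%N -> Mop D 1 j.+1 x = Hop D k 1 (Sbar D j.+1 x).
Proof. by move=> kj; rewrite Mop1E Eop_eop // Hop1. Qed.

(** The sum defining M_{i+2,j+1} is cut at nu = k + 2. Below the cut the entries of E factor through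
    \bar S_{j+1} and assemble into H_{i+2}; above it only nu = j + 1 contributes. *)
Lemma MopS_stab i j x : (i < k < j)%N ->
  Mop D i.+2 j.+1 x = Mop D i.+1 j x + Hop D k i.+2 (Sbar D j.+1 x).
Proof.
move=> ikj; rewrite MopE; last lia.
rewrite (@big_cat_nat _ _ _ k.+2) /=; [|lia|lia].
rewrite addrC; congr (_ + _).
  rewrite big_nat_recr /=; last lia.
  rewrite (rec_Ejj rec) // big1_seq ?add0r // => -[|[|nu]]; rewrite mem_index_iota.
  - by [].
  - by [].
  move=> nuj; rewrite Eop_stab; [|lia|lia].
  have [_ _ MB] := Eop_Mop_morphB nu.
  by rewrite (morphB0 (MB i.+1 _)) //; lia.
rewrite HopS; last lia.
apply: eq_big_nat => -[//|nu] nuk; rewrite Eop_eop //; lia.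
Qed.

(** The recurrence is followed along a diagonal down to row 1. The i steps lower j by i, and k + i <
    j keeps the last column in the stable range. *)
Lemma Mop_stab i j x : (i <= k)%N -> (k + i < j)%N ->
  Mop D i.+1 j.+1 x =
  \sum_(1 <= m < i.+2) Hop D k (i.+1 - m).+1 (Sbar D (j.+2 - m) x).
Proof.
elim: i j => [|i IH] j ik kij.
  by rewrite Mop1_stab ?big_nat1 ?subSS ?subn0 //; lia.
rewrite MopS_stab; last lia.
case: j kij => [|j] kij; first lia.
rewrite IH; [|lia|lia].
rewrite [in RHS]big_ltn // addrC subn1 /= subn1 /=; congr (_ + _).
by rewrite [RHS]big_add1.
Qed.

End Stabilized.
End Recursion.

Theorem lemma4 (R : realType) (s : scalar_kind)
    (B Bbar : lmodType (scalars R s)) (L : nat -> {linear B -> Bbar})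
    (L_neq0 : exists (i : nat) (b : B), L i b <> 0)
    (k : nat) (L_stab : stabilizes L k)
    (D : operators) (D_rec : recursion L D)
    (l : nat) (hl : (k.+1 <= l)%N) (i : nat) (hi : (1 <= i <= k.+1)%N) :
  Mop D i (k.+1 + l)%N =
    \sum_(1 <= j < i.+1) (Hop D k (i - j).+1 \o Sbar D (k.+2 + l - j)%N).
Proof.
case: i hi => [//|i] hi; apply/funext => x; rewrite fct_sumE.
(* Here j = k + l, and i <= k < l gives k + i < j. *)
by rewrite addSn (Mop_stab D_rec L_stab) //; lia.
Qed.
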